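(* For $\theta\in[-1,1)$ with $\theta\neq0$, let $C^{\mathrm{AMH}}_\theta(u,v)=\frac{uv}{1-\theta(1-u)(1-v)}$ be the Ali-Mikhail-Haq copula. Then Chatterjee's rank correlation of $C^{\mathrm{AMH}}_\theta$ is $$\xi\left(C^{\mathrm{AMH}}_\theta\right)=\frac3\theta-\frac\theta6-\frac23-\frac2{\theta^2}-\frac{2(\theta-1)^2\log(1-\theta)}{\theta^3}.$$
   Context: For a bivariate copula $C$, Chatterjee's rank correlation is $\xi(C)=6\int_0^1\int_0^1(\partial_1C(u,v))^2\,du\,dv-2$, where $\partial_1C$ is the (almost everywhere defined) partial derivative of $C$ with respect to its first argument. *)

(* Defs.v *)
From HB Require Import structures.
From mathcomp Require Import all_boot all_order all_algebra.
From mathcomp Require Import ring lra.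
From mathcomp Require Import all_classical all_reals all_analysis.
Import Order.TTheory GRing.Theory Num.Theory.
Import numFieldNormedType.Exports.

Set Implicit Arguments.
Unset Strict Implicit.
Unset Printing Implicit Defensive.

Local Open Scope classical_set_scope.
Local Open Scope ring_scope.

(* A bivariate copula is a function on the closed unit square; it is encoded
   as a total function on R x R whose values outside the square carry no
   meaning. *)
Record copula (R : realType) := Copula {
  copula_fun :> R -> R -> R ;
  copula0l : forall v, 0 <= v <= 1 -> copula_fun 0 v = 0 ;
  copula0r : forall u, 0 <= u <= 1 -> copula_fun u 0 = 0 ;
  copula1l : forall v, 0 <= v <= 1 -> copula_fun 1 v = v ;
  copula1r : forall u, 0 <= u <= 1 -> copula_fun u 1 = u ;
  copula_2increasing : forall u1 u2 v1 v2,
    0 <= u1 -> u1 <= u2 -> u2 <= 1 -> 0 <= v1 -> v1 <= v2 -> v2 <= 1 ->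
    0 <= copula_fun u2 v2 - copula_fun u2 v1
         - copula_fun u1 v2 + copula_fun u1 v1
}.

(* The derivative is the two-sided one, and it is a default value where the
   section is not derivable. For a copula that happens, for each v, on a null
   set of u in the unit interval. The values at the end points, where the
   derivative depends on the extension of C, do not contribute either. *)
Definition partial1 (R : realType) (C : R -> R -> R) (u v : R) : R :=
  derive1 (fun t : R => C t v) u.

(* Chatterjee's rank correlation, extended-real valued because the
   Lebesgue integral is. *)
Definition chatterjee_xi (R : realType) (C : copula R) : \bar R :=
  (6%:E * (\int[@lebesgue_measure R]_(v in `[0%R, 1%R])
             \int[@lebesgue_measure R]_(u in `[0%R, 1%R])
               ((partial1 C u v) ^+ 2)%:E)
   - 2%:E)%E.

Definition amh (R : realType) (theta u v : R) : R :=
  u * v / (1 - theta * (1 - u) * (1 - v)).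

Lemma amh_den_gt0 (R : realType) (theta u v : R) : -1 <= theta < 1 ->
  0 <= u <= 1 -> 0 <= v <= 1 -> 0 < 1 - theta * (1 - u) * (1 - v).
Proof.
move=> /andP[t1 t2] /andP[u0 u1] /andP[v0 v1].
have [ab0 ab1] : 0 <= (1 - u) * (1 - v) /\ (1 - u) * (1 - v) <= 1 by split; nra.
rewrite -mulrA; case: (lerP theta 0) => t0; nra.
Qed.

Lemma amh0l (R : realType) (theta v : R) : amh theta 0 v = 0.
Proof. by rewrite /amh !mul0r. Qed.

Lemma amh0r (R : realType) (theta u : R) : amh theta u 0 = 0.
Proof. by rewrite /amh mulr0 mul0r. Qed.

Lemma amh1l (R : realType) (theta v : R) : amh theta 1 v = v.
Proof. by rewrite /amh subrr mulr0 mul0r subr0 mul1r divr1. Qed.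

Lemma amh1r (R : realType) (theta u : R) : amh theta u 1 = u.
Proof. by rewrite /amh subrr mulr0 subr0 mulr1 divr1. Qed.

Lemma amh_2increasing (R : realType) (theta u1 u2 v1 v2 : R) :
  -1 <= theta < 1 ->
  0 <= u1 -> u1 <= u2 -> u2 <= 1 -> 0 <= v1 -> v1 <= v2 -> v2 <= 1 ->
  0 <= amh theta u2 v2 - amh theta u2 v1 - amh theta u1 v2 + amh theta u1 v1.
Proof.
move=> ht u10 u12 u21 v10 v12 v21; have /andP[t1 t2] := ht.
have iu1 : 0 <= u1 <= 1 by rewrite u10 (le_trans u12).
have iu2 : 0 <= u2 <= 1 by rewrite (le_trans u10).
have iv1 : 0 <= v1 <= 1 by rewrite v10 (le_trans v12).
have iv2 : 0 <= v2 <= 1 by rewrite (le_trans v10).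
have D11 := amh_den_gt0 ht iu1 iv1; have D12 := amh_den_gt0 ht iu1 iv2.
have D21 := amh_den_gt0 ht iu2 iv1; have D22 := amh_den_gt0 ht iu2 iv2.
pose D u v : R := 1 - theta * (1 - u) * (1 - v).
rewrite -/(D u1 v1) in D11; rewrite -/(D u1 v2) in D12.
rewrite -/(D u2 v1) in D21; rewrite -/(D u2 v2) in D22.
pose g v : R := v * (1 - theta * (1 - v)) / (D u1 v * D u2 v).
have -> : amh theta u2 v2 - amh theta u2 v1 - amh theta u1 v2 + amh theta u1 v1
    = (u2 - u1) * (g v2 - g v1).
  rewrite /amh /g -!/(D _ _) /D; field.
  by rewrite -/(D u1 v1) -/(D u1 v2) -/(D u2 v1) -/(D u2 v2) !gt_eqF.
apply: mulr_ge0; rewrite subr_ge0 // /g ler_pdivrMr ?mulr_gt0 //.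
rewrite mulrAC ler_pdivlMr ?mulr_gt0 //.
have iw1 : 0 <= 1 - theta * (1 - v1) by nra.
have iw2 : 0 <= 1 - theta * (1 - v2) by nra.
case: (lerP 0 theta) => t0.
- have A : v1 * D u1 v2 <= v2 * D u1 v1.
    by rewrite -subr_ge0 (_ : _ - _ = (v2 - v1) * (1 - theta * (1 - u1)));
      [apply: mulr_ge0; nra | rewrite /D; ring].
  have B : (1 - theta * (1 - v1)) * D u2 v2 <= (1 - theta * (1 - v2)) * D u2 v1.
    rewrite -subr_ge0 (_ : _ - _ = (v2 - v1) * (theta * u2)).
      by apply: mulr_ge0; nra.
    by rewrite /D; ring.
  rewrite [leLHS](_ : _ = (v1 * D u1 v2) * ((1 - theta * (1 - v1)) * D u2 v2));
    last by ring.
  rewrite [leRHS](_ : _ = (v2 * D u1 v1) * ((1 - theta * (1 - v2)) * D u2 v1));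
    last by ring.
  by apply: ler_pM => //; apply: mulr_ge0 => //; apply: ltW.
- have A : v1 * (1 - theta * (1 - v1)) <= v2 * (1 - theta * (1 - v2)).
    rewrite -subr_ge0 (_ : _ - _ = (v2 - v1) * (1 - theta + theta * (v1 + v2))).
      by apply: mulr_ge0; nra.
    by ring.
  have B u : 0 <= u <= 1 -> D u v2 <= D u v1.
    move=> /andP[? ?].
    rewrite -subr_ge0 (_ : _ - _ = (- theta) * (1 - u) * (v2 - v1)).
      by rewrite !mulr_ge0 //; lra.
    by rewrite /D; ring.
  apply: ler_pM => //; [exact: mulr_ge0|by rewrite mulr_ge0 ?ltW|].
  by apply: ler_pM; rewrite ?B // ltW.
Qed.

Definition amh_copula (R : realType) (theta : R) (htheta : -1 <= theta < 1) :
    copula R :=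
  Copula (fun v _ => amh0l theta v) (fun u _ => amh0r theta u)
    (fun v _ => amh1l theta v) (fun u _ => amh1r theta u)
    (fun u1 u2 v1 v2 => @amh_2increasing R theta u1 u2 v1 v2 htheta).

(* Main.v *)
(* Put [b = 1 - theta + theta v], which is positive since [theta < 1]. The
   denominator of the copula is [b + (1 - b) u], so the partial derivative in
   [u] is [v b / (b + (1 - b) u)^2]. The integral of its square over [u] is
   [v^2 (1 + b + b^2) / (3 b)], and since [v = (b - (1 - theta)) / theta] the
   integral of that over [v] is elementary, the term [v^2 / b] giving the
   logarithm. *)

Require Import Defs.
From mathcomp Require Import all_boot all_order all_algebra.
From mathcomp Require Import ring lra.
From mathcomp Require Import all_classical all_reals all_analysis.
Import Order.TTheory GRing.Theory Num.Theory.
Import numFieldNormedType.Exports.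
Local Open Scope ring_scope.

(** Fundamental theorem of calculus with two-sided derivatives up to the end points: they make [F]
    continuous there, and derivability of [f] yields the continuity of the integrand. *)
Lemma integral_is_derive (R : realType) (f F : R -> R) (a b : R) : a < b ->
  (forall x : R, a <= x <= b -> is_derive x 1 F (f x)) ->
  (forall x : R, a <= x <= b -> derivable f x 1) ->
  (\int[@lebesgue_measure R]_(x in `[a, b]%classic) (f x)%:E
    = (F b - F a)%:E)%E.
Proof.
move=> ab dF df.
have cF (x : R) : a <= x <= b -> {for x, continuous F}.
  by move=> /dF[? _]; apply/differentiable_continuous/derivable1_diffP.
rewrite EFinB; apply: continuous_FTC2 => //.
- apply: derivable_within_continuous => x; rewrite in_itv /=; exact: df.
- split.
  + by move=> x; rewrite in_itv /= => /andP[/ltW ? /ltW xb];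
      case: (dF x); rewrite ?xb ?andbT.
  + by apply: cvg_at_right_filter; apply: cF; rewrite lexx ltW.
  + by apply: cvg_at_left_filter; apply: cF; rewrite lexx ltW.
- move=> x; rewrite in_itv /= => /andP[/ltW ax /ltW xb].
  by rewrite derive1E; case: (dF x); rewrite ?ax.
Qed.

Lemma is_derive_affine (R : realType) (b c x : R) :
  is_derive x 1 (fun y : R => b + c * y) c.
Proof.
have H := is_deriveD (is_derive_cst b x 1)
  (is_deriveM (is_derive_cst c x 1) (is_derive_id x 1)).
by apply: (is_derive_eq H); rewrite /cst /= add0r scaler0 addr0 [LHS]mulr1.
Qed.

Lemma is_derive_div_affine (R : realType) (b c x : R) : b + c * x != 0 ->
  is_derive x 1 (fun y : R => y / (b + c * y)) (b / (b + c * x) ^+ 2).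
Proof.
move=> h; have H := is_deriveM (is_derive_id x 1)
  (is_deriveV (f := fun y => b + c * y) h (is_derive_affine _ b c x)).
by apply: (is_derive_eq H); rewrite /GRing.scale /=; field.
Qed.

(* Scaling in the module R over itself is multiplication; [/=] and [field] do
   not see this through the canonical instances. *)
Lemma scaleRE (R : realType) (a x : R) : a *: (x : R^o) = a * x.
Proof. by []. Qed.

(** The expression is the convex combination [(1 - x) * b + x * 1]. *)
Lemma conv_with1_gt0 (R : realType) (b x : R) : 0 < b -> 0 <= x <= 1 ->
  0 < b + (1 - b) * x.
Proof. by move=> b0 /andP[x0 x1]; nra. Qed.

(* With [w = u / (b + (1 - b) u)] one has [w' = b / (b + (1 - b) u)^2] and
   [1 - (1 - b) w = b / (b + (1 - b) u)], so the integrand [(v w')^2] is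
   [v^2 / b * (1 - (1 - b) w)^2 w'], a polynomial in [w] times [w']. This avoids
   dividing by [1 - b], which vanishes at [v = 1]. *)
Definition primitive_sqr_deriv (R : realType) (v b u : R) : R :=
  let w := u / (b + (1 - b) * u) in
  v ^+ 2 / b * (w - (1 - b) * w ^+ 2 + (1 - b) ^+ 2 / 3 * w ^+ 3).

Lemma is_derive_primitive_sqr_deriv (R : realType) (v b u : R) :
  b != 0 -> b + (1 - b) * u != 0 ->
  is_derive u 1 (primitive_sqr_deriv R v b)
    ((v * (b / (b + (1 - b) * u) ^+ 2)) ^+ 2).
Proof.
move=> b0 Du; pose w (u : R) := u / (b + (1 - b) * u).
have dw : is_derive u 1 w (b / (b + (1 - b) * u) ^+ 2).
  exact: is_derive_div_affine.
have H := is_deriveZ (v ^+ 2 / b) (is_deriveD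
  (is_deriveB dw (is_deriveZ (1 - b) (is_deriveX 2 dw)))
  (is_deriveZ ((1 - b) ^+ 2 / 3) (is_deriveX 3 dw))).
apply: (is_derive_eq H); rewrite ?scaleRE /= expr1.
have : 1 - (1 - b) * w u = b / (b + (1 - b) * u) by rewrite /w; field.
(* [W] and [D] become free variables linked only by [cW], which keeps the rational identity
   small. *)
move: (w u) Du => W; move: (b + (1 - b) * u) => D D0 cW.
rewrite [LHS](_ : _ = v ^+ 2 / D ^+ 2 * (1 - (1 - b) * W) ^+ 2).
  by rewrite cW; field.
by field; rewrite D0 b0.
Qed.

Lemma derivable_sqr_deriv (R : realType) (v b u : R) : b + (1 - b) * u != 0 ->
  derivable (fun u : R => (v * (b / (b + (1 - b) * u) ^+ 2)) ^+ 2) u 1.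
Proof.
move=> Du; have dD := is_derive_affine _ b (1 - b) u.
have D20 : (b + (1 - b) * u) ^+ 2 != 0 by rewrite expf_neq0.
have H := is_deriveX 2 (is_deriveZ v (is_deriveZ b (is_deriveV
    (f := fun y => (b + (1 - b) * y) ^+ 2) D20 (is_deriveX 2 dD)))).
by case: H.
Qed.

Lemma integral_sqr_deriv (R : realType) (v b : R) : 0 < b ->
  (\int[@lebesgue_measure R]_(u in `[0%R, 1%R]%classic)
     ((v * (b / (b + (1 - b) * u) ^+ 2)) ^+ 2)%:E
   = (v ^+ 2 * (1 + b + b ^+ 2) / (3 * b))%:E)%E.
Proof.
move=> b0.
pose f (u : R) := (v * (b / (b + (1 - b) * u) ^+ 2)) ^+ 2.
have D0 (x : R) (hx : 0 <= x <= 1) : b + (1 - b) * x != 0.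
  by rewrite lt0r_neq0 ?conv_with1_gt0.
have F' (x : R) (hx : 0 <= x <= 1) : is_derive x 1 (primitive_sqr_deriv R v b) (f x).
  exact: is_derive_primitive_sqr_deriv (lt0r_neq0 b0) (D0 x hx).
have f' (x : R) (hx : 0 <= x <= 1) : derivable f x 1.
  exact: derivable_sqr_deriv (D0 x hx).
have -> := integral_is_derive R f _ 0 1 ltr01 F' f'.
(* The denominator is [1] at [u = 1], so [w] runs from [0] to [1]. *)
rewrite /primitive_sqr_deriv mul0r mulr1 (addrC b) subrK divr1; congr (_%:E).
by field; rewrite lt0r_neq0.
Qed.

(** With [b = (1 - t) + t * v], the integrand is a third of [v^2 / b + v^2 + v^2 * b]. Division
    gives [v^2 / b = v / t - (1 - t) / t^2 + (1 - t)^2 / (t^2 * b)], and the other two terms sum to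
    [(2 - t) * v^2 + t * v^3]. *)
Definition primitive_amh_section (R : realType) (t v : R) : R :=
  3^-1 * ((2 * t)^-1 * v ^+ 2 - (1 - t) / t ^+ 2 * v
    + (1 - t) ^+ 2 / t ^+ 3 * ln ((1 - t) + t * v)
    + (2 - t) / 3 * v ^+ 3 + t / 4 * v ^+ 4).

Lemma is_derive_primitive_amh_section (R : realType) (t v : R) :
  t != 0 -> 0 < (1 - t) + t * v ->
  is_derive v 1 (primitive_amh_section R t)
    (v ^+ 2 * (1 + ((1 - t) + t * v) + ((1 - t) + t * v) ^+ 2)
       / (3 * ((1 - t) + t * v))).
Proof.
move=> t0 b0; have dv := is_derive_id v (1 : R).
have dl := is_derive1_comp (g := fun y => (1 - t) + t * y) (is_derive1_ln b0)
   (is_derive_affine R (1 - t) t v).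
have H := is_deriveZ 3^-1 (is_deriveD (is_deriveD (is_deriveD
  (is_deriveB (is_deriveZ (2 * t)^-1 (is_deriveX 2 dv))
    (is_deriveZ ((1 - t) / t ^+ 2) dv))
  (is_deriveZ ((1 - t) ^+ 2 / t ^+ 3) dl))
  (is_deriveZ ((2 - t) / 3) (is_deriveX 3 dv)))
  (is_deriveZ (t / 4) (is_deriveX 4 dv))).
apply: (is_derive_eq H); rewrite ?scaleRE /=.
by field; rewrite t0 lt0r_neq0.
Qed.

Lemma derivable_amh_section (R : realType) (t v : R) : (1 - t) + t * v != 0 ->
  derivable (fun v : R => v ^+ 2 * (1 + ((1 - t) + t * v)
    + ((1 - t) + t * v) ^+ 2) / (3 * ((1 - t) + t * v))) v 1.
Proof.
move=> b0; have dv := is_derive_id v (1 : R).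
have db := is_derive_affine R (1 - t) t v.
have b30 : 3 * ((1 - t) + t * v) != 0 by rewrite mulf_neq0.
have H := is_deriveM (is_deriveM (is_deriveX 2 dv)
   (is_deriveD (is_deriveD (is_derive_cst (1 : R) v 1) db) (is_deriveX 2 db)))
  (is_deriveV (f := fun y => 3 * ((1 - t) + t * y)) b30 (is_deriveZ 3 db)).
by case: H.
Qed.

Lemma integral_amh_section (R : realType) (t : R) : t != 0 ->
  (forall v : R, 0 <= v <= 1 -> 0 < (1 - t) + t * v) ->
  (\int[@lebesgue_measure R]_(v in `[0%R, 1%R]%classic)
     (v ^+ 2 * (1 + ((1 - t) + t * v) + ((1 - t) + t * v) ^+ 2)
       / (3 * ((1 - t) + t * v)))%:E
   = ((1 / (2 * t) - (1 - t) / t ^+ 2 - (1 - t) ^+ 2 * ln (1 - t) / t ^+ 3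
        + (2 - t) / 3 + t / 4) / 3)%:E)%E.
Proof.
move=> t0 b0.
have F' (x : R) (hx : 0 <= x <= 1) :=
  is_derive_primitive_amh_section R t x t0 (b0 x hx).
have f' (x : R) (hx : 0 <= x <= 1) :=
  derivable_amh_section R t x (lt0r_neq0 (b0 x hx)).
have -> := integral_is_derive R _ _ 0 1 ltr01 F' f'.
(* The logarithm vanishes at [v = 1]; only [ln (1 - t)] from [v = 0] survives. *)
rewrite /primitive_amh_section !mulr0 !addr0 mulr1 subrK ln1; congr (_%:E).
by field.
Qed.

(** With [b = 1 - t + t * v], one has [1 - t * (1 - u) * (1 - v) = 1 - (1 - b) * (1 - u) = b + (1 -
    b) * u]. *)
Lemma partial1_amh (R : realType) (t u v : R) :
  (1 - t + t * v) + (1 - (1 - t + t * v)) * u != 0 ->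
  partial1 (amh t) u v =
  v * ((1 - t + t * v) / ((1 - t + t * v) + (1 - (1 - t + t * v)) * u) ^+ 2).
Proof.
move=> D0; rewrite /partial1 derive1E.
rewrite (_ : (fun t => _) = v \*: (fun y : R =>
  y / ((1 - t + t * v) + (1 - (1 - t + t * v)) * y))).
  apply: derive_val; apply: is_deriveZ; exact: is_derive_div_affine.
apply/funext => x; rewrite /amh /= -[RHS]/(v * _) mulrCA mulrA.
by congr (_ / _); ring.
Qed.

Theorem mainTheorem8 (R : realType) (theta : R) (htheta : -1 <= theta < 1)
    (theta_neq0 : theta <> 0) :
  chatterjee_xi (amh_copula htheta) =
  (3 / theta - theta / 6 - 2 / 3 - 2 / theta ^+ 2
   - 2 * (theta - 1) ^+ 2 * ln (1 - theta) / theta ^+ 3)%:E.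
Proof.
have theta0 : theta != 0 by apply/eqP.
(* This is [(1 - v) * (1 - theta) + v], a convex combination of positive numbers. *)
have b0 (v : R) (hv : 0 <= v <= 1) : 0 < 1 - theta + theta * v.
  by case/andP: htheta hv => ? ? /andP[? ?]; nra.
rewrite /chatterjee_xi /=.
rewrite (_ : integral _ _ _ = ((1 / (2 * theta) - (1 - theta) / theta ^+ 2
   - (1 - theta) ^+ 2 * ln (1 - theta) / theta ^+ 3
   + (2 - theta) / 3 + theta / 4) / 3)%:E).
  by rewrite -EFinM -EFinB; congr (_%:E); field.
(* Both integrals are folded back, leaving integrands to compare. They agree at every point of the
   closed square, since the denominator is positive there. *)
rewrite -(integral_amh_section R theta theta0 b0).
apply: eq_integral => v; rewrite inE /= in_itv /= => hv.
rewrite -(integral_sqr_deriv R v _ (b0 v hv)).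
apply: eq_integral => u; rewrite inE /= in_itv /= => hu.
by rewrite partial1_amh // lt0r_neq0 // conv_with1_gt0 // b0.
Qed.
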